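(* Let $\lambda_{\max}\in(0,\infty]$, let $\psi:[0,\lambda_{\max})\to\mathbb R$ be any function and let $l_0\in[1,\infty)$. Let $\mathbb S^{l_0}_\psi$ be the class of pairs $(S_t,V_t)$ such that $(S_t)$ is $l_0$-sub-$\psi$ with variance process $(V_t)$ (see context). Below, ''$\sup_{(S_t,V_t)\in\mathbb S^{l_0}_\psi}\mathbb P(\cdot\mid\mathcal F_0)\le C$'' means that for every pair $(S_t,V_t)\in\mathbb S^{l_0}_\psi$ the conditional probability given $\mathcal F_0$ is at most $C$ almost surely. (a) For any $a,b>0$, $$\sup_{(S_t,V_t)\in\mathbb S^{l_0}_\psi}\mathbb P\left(\exists t\in\mathcal T: S_t\ge a+bV_t\mid\mathcal F_0\right)\le l_0\exp\{-aD(b)\}.$$ Additionally, whenever $\psi$ is CGF-like, the following three statements hold and each is equivalent to statement (a): (b) For any $m>0$ and $x\in(0,m\bar b)$, $$\sup_{(S_t,V_t)\in\mathbb S^{l_0}_\psi}\mathbb P\left(\exists t\in\mathcal T: S_t\ge x+\mathfrak s\left(\tfrac xm\right)(V_t-m)\,\middle|\,\mathcal F_0\right)\le l_0\exp\left\{-m\psi^\star\left(\tfrac xm\right)\right\}.$$ (c) For any $m>0$ and $x\in(0,\bar b)$, $$\sup_{(S_t,V_t)\in\mathbb S^{l_0}_\psi}\mathbb P\left(\exists t\in\mathcal T: \frac{S_t}{V_t}\ge x-\left(\frac{x-\mathfrak s(x)}{V_t}\right)(V_t-m)\,\middle|\,\mathcal F_0\right)\le l_0\exp\{-m\psi^\star(x)\}.$$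 (d) For any $m\ge0$, $x>0$ and $b>0$ (taking $m\bar b=\infty$ whenever $\bar b=\infty$), $$\sup_{(S_t,V_t)\in\mathbb S^{l_0}_\psi}\mathbb P\left(\exists t\in\mathcal T: V_t\ge m\text{ and }S_t\ge x+b(V_t-m)\mid\mathcal F_0\right)\le\begin{cases}l_0\exp\{-(x-(b\wedge\bar b)m)D(b)\}, & x>m\bar b\text{ or }\mathfrak s(x/m)>b,\\ l_0\exp\{-m\psi^\star(x/m)\}, & x\le m\bar b\text{ and }\mathfrak s(x/m)\le b,\end{cases}$$ where for $m=0$ the first case is the one that applies.
   Context: Time index: either $\mathcal T=\mathbb N=\{1,2,\dots\}$ (discrete time) or $\mathcal T=(0,\infty)$ (continuous time). Processes are adapted to a filtration $(\mathcal F_t)_{t\in\mathcal T\cup\{0\}}$; in continuous time the filtration is right-continuous and complete, and $(S_t),(V_t)$ are càdlàg. Sub-$\psi$ process: let $(S_t)_{t\in\mathcal T\cup\{0\}}$, $(V_t)_{t\in\mathcal T\cup\{0\}}$ be real-valued adapted processes with $S_0=V_0=0$ a.s. and $V_t\ge0$ a.s. for all $t\in\mathcal T$. For $\psi:[0,\lambda_{\max})\to\mathbb R$ and $l_0\in[1,\infty)$, $(S_t)$ is $l_0$-sub-$\psi$ with variance process $(V_t)$ if for each $\lambda\in[0,\lambda_{\max})$ there is a supermartingale $(L_t(\lambda))_{t\in\mathcal T\cup\{0\}}$ with respect to $(\mathcal F_t)$ with $L_0(\lambda)\le l_0$ a.s. and $\exp\{\lambda S_t-\psi(\lambda)V_t\}\le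 L_t(\lambda)$ a.s. for all $t\in\mathcal T$. $\mathbb S^{l_0}_\psi$ denotes the class of all such pairs $(S_t,V_t)$. CGF-like: $\psi:[0,\lambda_{\max})\to\mathbb R$ is CGF-like if it is strictly convex, twice continuously differentiable, $\psi(0)=\psi'(0_+)=0$ and $\sup_{\lambda\in[0,\lambda_{\max})}\psi(\lambda)=\infty$. Then $\bar b:=\sup_{\lambda\in[0,\lambda_{\max})}\psi'(\lambda)\in(0,\infty]$. Transforms: $\psi^\star(u):=\sup_{\lambda\in[0,\lambda_{\max})}[\lambda u-\psi(\lambda)]$ for $u\ge0$; $D(u):=\sup\{\lambda\in(0,\lambda_{\max}):\psi(\lambda)/\lambda\le u\}$ for $u\ge0$, with $\sup\emptyset=0$ ($D(u)$ may be $+\infty$, and $e^{-\infty}=0$); for CGF-like $\psi$, $\mathfrak s(u):=\psi({\psi^\star}'(u))/{\psi^\star}'(u)$ for $u\in(0,\bar b)$, with $\mathfrak s(0)=0$ and $\mathfrak s(\bar b)=\bar b$ when $\bar b<\infty$. In (c), the inequality between ratios is read after multiplying through by $V_t$ when $V_t=0$, i.e. as $S_t\ge mx+\mathfrak s(x)(V_t-m)$. $u\wedge v=\min(u,v)$. *)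

(* Defs.v *)
From HB Require Import structures.
From mathcomp Require Export all_boot all_order all_algebra.
From mathcomp Require Export all_classical all_reals all_analysis.
Export Order.TTheory GRing.Theory Num.Theory.
Export numFieldNormedType.Exports.

Set Implicit Arguments.
Unset Strict Implicit.
Unset Printing Implicit Defensive.

Global Open Scope classical_set_scope.
Global Open Scope ring_scope.

(* Both time sets are embedded in R, so that a process is a function
   R -> Omega -> R of which only the values at the times of [times0] matter. *)
Variant time_kind := Discrete | Continuous.

Definition times (R : realType) (k : time_kind) : set R :=
  match k with
  | Discrete => [set t | exists2 n : nat, (0 < n)%N & t = n%:R]
  | Continuous => [set t | 0 < t]
  end.

Definition times0 (R : realType) (k : time_kind) : set R := 0 |` @times R k.

Definition meas_wrt (T : Type) (R : realType) (G : set (set T)) (X : T -> R) :=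
  forall B : set R, measurable B -> G (X @^-1` B).

(* Right-continuity and completeness (F_0, hence every F_t, contains all
   negligible sets, so that in particular P is complete) are required in
   continuous time only. *)
Definition is_filtration (d : measure_display) (T : measurableType d)
    (R : realType) (k : time_kind) (P : probability T R)
    (F : R -> set (set T)) : Prop :=
  [/\ forall t, times0 k t -> sigma_algebra setT (F t) /\ F t `<=` measurable,
      forall s t, times0 k s -> times0 k t -> s <= t -> F s `<=` F t
    & k = Continuous ->
        (forall t, 0 <= t -> F t = \bigcap_(s in [set s | t < s]) F s) /\
        (forall N, P.-negligible N -> F 0 N)].

Definition adapted (T : Type) (R : realType) (k : time_kind)
    (F : R -> set (set T)) (X : R -> T -> R) : Prop :=
  forall t, times0 k t -> meas_wrt (F t) (X t).

Definition cadlag (R : realType) (x : R -> R) : Prop :=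
  (forall t, 0 <= t -> x s @[s --> t^'+] --> x t) /\
  (forall t, 0 < t -> cvg (x s @[s --> t^'-])).

(* Y is a version of E[X | G]. For G a sub-sigma-algebra and X integrable,
   versions exist (Radon-Nikodym) and agree almost surely, so that an almost
   sure bound on one version is the same as a bound on every version. *)
Definition is_cond_exp (d : measure_display) (T : measurableType d)
    (R : realType) (P : probability T R) (G : set (set T)) (X Y : T -> R) :
    Prop :=
  [/\ meas_wrt G Y, P.-integrable setT (EFin \o Y)
    & forall A, G A ->
        (\int[P]_(w in A) (Y w)%:E = \int[P]_(w in A) (X w)%:E)%E].

(* P(E | G) <= c almost surely. If E is measurable, one may take E' = E, and
   the existence of any E' gives the bound for E by monotonicity. The set E' is
   there because an event "exists t, ..." over uncountably many times is only
   known to be measurable through the measurable projection theorem; the bound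
   is then meant for the outer conditional probability. *)
Definition cond_prob_le (d : measure_display) (T : measurableType d)
    (R : realType) (P : probability T R) (G : set (set T)) (E : set T)
    (c : \bar R) : Prop :=
  exists (E' : set T) (Y : T -> R),
    [/\ measurable E', E `<=` E', is_cond_exp P G (\1_E') Y
      & {ae P, forall w, ((Y w)%:E <= c)%E}].

Definition supermartingale (d : measure_display) (T : measurableType d)
    (R : realType) (k : time_kind) (P : probability T R)
    (F : R -> set (set T)) (L : R -> T -> R) : Prop :=
  [/\ adapted k F L,
      forall t, times0 k t -> P.-integrable setT (EFin \o L t)
    & forall s t, times0 k s -> times0 k t -> s <= t ->
        exists2 Y, is_cond_exp P (F s) (L t) Y
                 & {ae P, forall w, Y w <= L s w}].

Definition process_pair (T : Type) (R : realType) : Type :=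
  ((R -> T -> R) * (R -> T -> R))%type.

Definition admissible_pairs (d : measure_display) (T : measurableType d)
    (R : realType) (k : time_kind) (P : probability T R)
    (F : R -> set (set T)) : set (process_pair T R) :=
  [set SV | let S := SV.1 in let V := SV.2 in
    [/\ adapted k F S /\ adapted k F V,
        {ae P, forall w, S 0 w = 0} /\ {ae P, forall w, V 0 w = 0},
        forall t, times k t -> {ae P, forall w, 0 <= V t w}
      & k = Continuous ->
          {ae P, forall w, cadlag (S ^~ w)} /\
          {ae P, forall w, cadlag (V ^~ w)}]].

Definition psi_dom (R : realType) (lmax : \bar R) : set R :=
  [set l | 0 <= l /\ (l%:E < lmax)%E].

(* The class S^{l0}_psi of pairs (S, V) such that S is l0-sub-psi with
   variance process V. *)
Definition sub_psi_class (d : measure_display) (T : measurableType d)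
    (R : realType) (k : time_kind) (P : probability T R)
    (F : R -> set (set T)) (lmax : \bar R) (psi : R -> R) (l0 : R) :
    set (process_pair T R) :=
  [set SV | admissible_pairs k P F SV /\
    forall l, psi_dom lmax l ->
      exists L : R -> T -> R,
        [/\ supermartingale k P F L,
            {ae P, forall w, L 0 w <= l0}
          & forall t, times k t ->
              {ae P, forall w,
                 expR (l * SV.1 t w - psi l * SV.2 t w) <= L t w}]].

(* psi is only required to be C^2 on the open interval, with psi'(0+) = 0 as
   the right derivative at 0 (which entails right-continuity at 0). *)
Definition cgf_like (R : realType) (lmax : \bar R) (psi : R -> R) : Prop :=
  [/\ forall x y t : R, psi_dom lmax x -> psi_dom lmax y -> x != y ->
        0 < t < 1 ->
        psi (t * x + (1 - t) * y) < t * psi x + (1 - t) * psi y,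
      forall l : R, 0 < l -> (l%:E < lmax)%E ->
        [/\ derivable psi l 1, derivable psi^`()%classic l 1
          & {for l, continuous psi^`(2)%classic}],
      psi 0 = 0,
      (psi h - psi 0) / h @[h --> 0^'+] --> 0
    & ereal_sup [set (psi l)%:E | l in psi_dom lmax] = +oo%E].

(* The point 0, where the one-sided derivative is 0, is left out; this does not
   affect the supremum, as psi' > 0 on the open interval. *)
Definition bbar (R : realType) (lmax : \bar R) (psi : R -> R) : \bar R :=
  ereal_sup [set (psi^`()%classic l)%:E | l in
    [set l | 0 < l /\ (l%:E < lmax)%E]].

Definition psi_star (R : realType) (lmax : \bar R) (psi : R -> R) (u : R) :
    \bar R :=
  ereal_sup [set (l * u - psi l)%:E | l in psi_dom lmax].

(* Adjoining 0 to a set of positive numbers implements sup set0 = 0. *)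
Definition Dtransf (R : realType) (lmax : \bar R) (psi : R -> R) (u : R) :
    \bar R :=
  ereal_sup (0%E |` [set l%:E | l in
    [set l | [/\ 0 < l, (l%:E < lmax)%E & psi l / l <= u]]]).

(* psi_star is finite on ]0, bbar[, so that [fine] is harmless there; only the
   values of [slope_transf] on [0, bbar] are meaningful. *)
Definition slope_transf (R : realType) (lmax : \bar R) (psi : R -> R)
    (u : R) : R :=
  if u == 0 then 0
  else if u%:E == bbar lmax psi then u
  else let l := (fun v => fine (psi_star lmax psi v))^`()%classic u in psi l / l.

Definition line_crossing_a (d : measure_display) (T : measurableType d)
    (R : realType) (k : time_kind) (P : probability T R)
    (F : R -> set (set T)) (lmax : \bar R) (psi : R -> R) (l0 : R)
    (C : set (process_pair T R)) : Prop :=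
  forall a b : R, 0 < a -> 0 < b ->
  forall S V : R -> T -> R, C (S, V) ->
  cond_prob_le P (F 0)
    [set w | exists2 t, times k t & S t w >= a + b * V t w]
    (l0%:E * expeR (- (a%:E * Dtransf lmax psi b)))%E.

Definition line_crossing_b (d : measure_display) (T : measurableType d)
    (R : realType) (k : time_kind) (P : probability T R)
    (F : R -> set (set T)) (lmax : \bar R) (psi : R -> R) (l0 : R)
    (C : set (process_pair T R)) : Prop :=
  forall m x : R, 0 < m -> 0 < x -> (x%:E < m%:E * bbar lmax psi)%E ->
  forall S V : R -> T -> R, C (S, V) ->
  cond_prob_le P (F 0)
    [set w | exists2 t, times k t &
       S t w >= x + slope_transf lmax psi (x / m) * (V t w - m)]
    (l0%:E * expeR (- (m%:E * psi_star lmax psi (x / m))))%E.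

Definition line_crossing_c (d : measure_display) (T : measurableType d)
    (R : realType) (k : time_kind) (P : probability T R)
    (F : R -> set (set T)) (lmax : \bar R) (psi : R -> R) (l0 : R)
    (C : set (process_pair T R)) : Prop :=
  forall m x : R, 0 < m -> 0 < x -> (x%:E < bbar lmax psi)%E ->
  forall S V : R -> T -> R, C (S, V) ->
  cond_prob_le P (F 0)
    [set w | exists2 t, times k t &
       if V t w == 0 then
         S t w >= m * x + slope_transf lmax psi x * (V t w - m)
       else
         S t w / V t w >=
           x - (x - slope_transf lmax psi x) / V t w * (V t w - m)]
    (l0%:E * expeR (- (m%:E * psi_star lmax psi x)))%E.

(* For m > 0 and bbar = +oo, [m%:E * bbar] is +oo; the case m = 0 is made
   explicit. *)
Definition line_crossing_d (d : measure_display) (T : measurableType d)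
    (R : realType) (k : time_kind) (P : probability T R)
    (F : R -> set (set T)) (lmax : \bar R) (psi : R -> R) (l0 : R)
    (C : set (process_pair T R)) : Prop :=
  forall m x b : R, 0 <= m -> 0 < x -> 0 < b ->
  forall S V : R -> T -> R, C (S, V) ->
  cond_prob_le P (F 0)
    [set w | exists2 t, times k t &
       V t w >= m /\ S t w >= x + b * (V t w - m)]
    (if [|| m == 0, (m%:E * bbar lmax psi < x%:E)%E
          | b < slope_transf lmax psi (x / m)]
     then (l0%:E * expeR (- ((x%:E - mine b%:E (bbar lmax psi) * m%:E)
                             * Dtransf lmax psi b)))%E
     else (l0%:E * expeR (- (m%:E * psi_star lmax psi (x / m))))%E).

(* Main.v *)
From HB Require Import structures.
From mathcomp Require Import measurable_realfun.
From mathcomp Require Import ring lra.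
Require Import Defs.

(* For 0 < l < lmax with psi l / l <= b, on the event S_t >= a + b V_t the
   process exp(l S_t - psi l V_t) is at least exp(l a). It is dominated by a
   supermartingale starting below l0, so Ville's inequality bounds the
   conditional probability of the event by l0 exp(- l a); (a) follows by
   optimising over l. In continuous time the supermartingale need not be
   cadlag and the domination is almost sure for each fixed time only, so Ville's
   inequality is used along the positive rationals, and right-continuity of S
   and V transfers the bound to all times at the price of lowering a slightly.

   For CGF-like psi and 0 < l < lmax, put u = psi' l and r = psi l / l. Then
   D(r) = l, s(u) = r and psi_star(u) = l u - psi l = l (u - r), and u, r range
   over ]0, bbar[. Hence (b) and (c) are the bound for the lines of slope r,
   reparametrised, and (a) and (d) follow from it; slopes b >= bbar can occur
   only if lmax is infinite, and are reached by letting l tend to infinity. *)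

Set Implicit Arguments.
Unset Strict Implicit.
Unset Printing Implicit Defensive.

Lemma exists_natSinv_lt (R : realType) (e : R) : 0 < e ->
  exists n : nat, n.+1%:R^-1 < e.
Proof.
move=> e0; exists (Num.truncn e^-1).
by rewrite -[ltRHS]invrK ltf_pV2 ?posrE ?invr_gt0// truncnS_gt.
Qed.

(** * Conditional probabilities and Ville's inequality *)

Section conditional_bounds.
Context d (T : measurableType d) (R : realType) (P : probability T R).

Lemma ae_le_integral (D : set T) (f g : T -> \bar R) : measurable D ->
  P.-integrable D f -> P.-integrable D g ->
  {ae P, forall w, (f w <= g w)%E} ->
  (\int[P]_(w in D) f w <= \int[P]_(w in D) g w)%E.
Proof.
move=> mD fi gi [N [mN PN fgN]].
rewrite (negligible_integral mN mD fi PN) (negligible_integral mN mD gi PN).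
have mDN : measurable (D `\` N) by exact: measurableD.
apply: le_integral => //.
- exact: (integrableS mD).
- exact: (integrableS mD).
- by move=> w; rewrite inE => -[_ Nw]; apply: contrapT => fg; exact/Nw/fgN.
Qed.

(** * Existence of conditional probabilities *)

Section conditional_expectation.
Variable G : set (set T).
Hypotheses (sG : sigma_algebra setT G) (Gm : G `<=` measurable).

(** The target carries the sigma-algebra [G]: the pushforward of [P] along this identity is the
    restriction of [P] to [G]. *)
Definition sub_id : T -> g_sigma_algebraType G := id.

Lemma measurable_sub_id : measurable_fun setT sub_id.
Proof.
move=> _ Y; rewrite (measurable_g_measurableTypeE sG) => GY.
by rewrite setTI; exact: Gm.
Qed.

HB.instance Definition _ := isMeasurableFun.Build _ _ _ _ sub_id measurable_sub_id.

(** As a measure on [G], it is dominated by the restriction of [P], and its Radon-Nikodym density is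
    a version of P(E | G). *)
Definition trace_prob (E : set T) (A : set (g_sigma_algebraType G)) : \bar R :=
  P (A `&` E).

Variable E : set T.
Hypothesis mE : measurable E.

Let trace_prob0 : trace_prob E set0 = 0%E.
Proof. by rewrite /trace_prob set0I measure0. Qed.

Let trace_prob_ge0 A : (0 <= trace_prob E A)%E.
Proof. exact: measure_ge0. Qed.

Let trace_prob_sigma_additive : semi_sigma_additive (trace_prob E).
Proof.
have mf := measurable_sub_id.
exact: (@measure_semi_sigma_additive _ _ _
  (@pushforward _ _ _ _ R (mrestr P mE) sub_id)).
Qed.

HB.instance Definition _ := isMeasure.Build _ _ _ (trace_prob E)
  trace_prob0 trace_prob_ge0 trace_prob_sigma_additive.

Let trace_prob_fin : fin_num_fun (trace_prob E).
Proof.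
move=> A; rewrite (measurable_g_measurableTypeE sG) => /Gm mA.
by rewrite fin_num_measure//; exact: measurableI.
Qed.

HB.instance Definition _ := Measure_isFinite.Build _ _ _ (trace_prob E)
  trace_prob_fin.

Lemma cond_exp_indic_exists : exists Y, is_cond_exp P G (\1_E) Y.
Proof.
have [|f [f0 ff fi fE]] := @radon_nikodym_sigma_finite _ _ _
    (distribution P sub_id) (trace_prob E).
  apply/null_content_dominatesP => A; rewrite (measurable_g_measurableTypeE sG).
  move=> GA PA; apply/eqP; rewrite eq_le measure_ge0 andbT.
  by rewrite -PA; apply: le_measure; rewrite ?inE//;
    [apply: measurableI => //|]; exact: Gm.
exists (fine \o f).
have fine_f : EFin \o (fine \o f) = f by apply/funext => w /=; rewrite fineK.
have /integrableP[mf fioo] := fi.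

have mfT := measurableT_comp mf measurable_sub_id.
split.
- move=> B mB; rewrite -(measurable_g_measurableTypeE sG) -[X in measurable X]setTI.
  exact: (measurable_comp measurableT _ (fine_measurable measurableT) mf).
- rewrite fine_f; apply/integrableP; split=> //.
  move: fioo; by rewrite ge0_integral_pushforward//; exact: measurableT_comp.
- move=> A GA; have mA := Gm GA.
  rewrite -[X in integral _ _ X]/(EFin \o (fine \o f)) fine_f.
  rewrite integral_indic// setIC -[RHS]/(trace_prob E A) fE; last first.
    by rewrite (measurable_g_measurableTypeE sG).
  rewrite ge0_integral_pushforward//.
    by rewrite (measurable_g_measurableTypeE sG).
  exact: measurable_funTS.
Qed.

End conditional_expectation.

(** * Calculus of conditional bounds *)

Section cond_prob_bounds.
Variable G : set (set T).
Hypotheses (sG : sigma_algebra setT G) (Gm : G `<=` measurable).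

(* Integrated over the sets of G, the bound no longer mentions a version of
   the conditional probability. *)
Lemma cond_prob_leP (E : set T) (c : R) :
  cond_prob_le P G E c%:E <->
  exists E', [/\ measurable E', E `<=` E' &
    forall A, G A -> (P (A `&` E') <= c%:E * P A)%E].
Proof.
split=> [[E' [Y [mE' EE' [mY iY YE] Yc]]]|[E' [mE' EE' E'c]]].
  exists E'; split=> // A GA; have mA := Gm GA.
  rewrite setIC -integral_indic// -YE// -integral_cst//.
  apply: ae_le_integral => //; first exact: (integrableS measurableT).
  exact: finite_measure_integrable_cst.
have [Y [mY iY YE]] := cond_exp_indic_exists sG Gm mE'.
exists E', Y; split=> //.
(* The set where Y > c is the union of these sets of [G]; integrating [Y] over each of them against
   the hypothesis forces it to be null. *)
pose A n := Y @^-1` `[c + n.+1%:R^-1, +oo[.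
have GA n : G (A n) by apply: mY; exact: measurable_itv.
have PA0 n : P (A n) = 0%E.
  have mA := Gm (GA n).
  have le1 : ((c + n.+1%:R^-1)%:E * P (A n) <= \int[P]_(w in A n) (Y w)%:E)%E.
    rewrite -integral_cst//; apply: le_integral => //.
    - exact: finite_measure_integrable_cst.
    - exact: (integrableS measurableT).
    - by move=> w; rewrite inE /A /= in_itv/= andbT lee_fin.
  have := le_trans le1 _; move/(_ (c%:E * P (A n))%E).
  rewrite (YE _ (GA n)) integral_indic//.
  rewrite setIC => /(_ (E'c _ (GA n))).
  have Pfin : P (A n) \is a fin_num by exact: fin_num_measure.
  rewrite -(fineK Pfin) -!EFinM lee_fin => h; congr EFin.
  apply/eqP; rewrite eq_le fine_ge0 ?measure_ge0// andbT.
  move: h; rewrite mulrDl gerDl pmulr_rle0// invr_gt0.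
have : P.-negligible (\bigcup_n A n).
  apply: negligible_bigcup => n.
  by apply/(negligibleP P (Gm (GA n)))/PA0.
apply: negligibleS => w /= /negP; rewrite lee_fin -ltNge => cY.
have [|n nY] := @exists_natSinv_lt _ (Y w - c); first by rewrite subr_gt0.
exists n => //; rewrite /A /= in_itv/= andbT.
by rewrite -lerBrDl ltW.
Qed.

(** The exceptional null set is added to the measurable cover of [E2]; the cover need not belong to
    [G], so no completeness of [G] is involved. *)
Lemma cond_prob_le_ae (E1 E2 : set T) (c1 c2 : R) :
  {ae P, forall w, E1 w -> E2 w} -> c1 <= c2 ->
  cond_prob_le P G E2 c1%:E -> cond_prob_le P G E1 c2%:E.
Proof.
move=> [N [mN PN E12N]] c12 /cond_prob_leP[E' [mE' E2E' E'c]].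
apply/cond_prob_leP; exists (E' `|` N); split.
- exact: measurableU.
- move=> w E1w; have [Nw|Nw] := pselect (N w); [by right|left].
  by apply: E2E'; apply: contrapT => E2w; apply/Nw/E12N => /= /(_ E1w).
- move=> A GA; have mA := Gm GA.
  rewrite setIUr; apply: (@le_trans _ _ (P (A `&` E') + P (A `&` N))%E).
    by apply: measureU2; exact: measurableI.
  rewrite [X in (_ + X)%E](_ : _ = 0%E) ?adde0.
    apply: (le_trans (E'c _ GA)).
    by rewrite lee_wpmul2r// lee_fin.
  apply/eqP; rewrite eq_le measure_ge0 andbT -PN.
  by apply: le_measure; rewrite ?inE//; exact: measurableI.
Qed.

(** Each [e] comes with its own measurable cover of [E]; the intersection of the covers for e =
    1/(n+1) satisfies all the bounds at once. *)
Lemma cond_prob_le_inf (E : set T) (c : R) :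
  (forall e, 0 < e -> cond_prob_le P G E (c + e)%:E) ->
  cond_prob_le P G E c%:E.
Proof.
move=> Ec.
have /choice[E' E'c] : forall n : nat, exists E', [/\ measurable E', E `<=` E' &
    forall A, G A -> (P (A `&` E') <= (c + n.+1%:R^-1)%:E * P A)%E].
  by move=> n; apply/cond_prob_leP/Ec.
apply/cond_prob_leP; exists (\bigcap_n E' n); split.
- by apply: bigcapT_measurable => n; case: (E'c n).
- by move=> w Ew n _; case: (E'c n) => _ + _; apply.
- move=> A GA; have mA := Gm GA.
  have PA : P A \is a fin_num by exact: fin_num_measure.
  have mI : measurable (\bigcap_n E' n).
    by apply: bigcapT_measurable => n; case: (E'c n).
  apply/lee_addgt0Pr => e e0.
  have [n ne] := exists_natSinv_lt e0.
  have [mE' _ /(_ _ GA) PE'] := E'c n.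
  apply: (@le_trans _ _ (P (A `&` E' n))).
    apply: le_measure; rewrite ?inE//; [exact: measurableI..|].
    by move=> w [Aw E'w]; split=> //; exact: E'w.
  apply: (le_trans PE'); rewrite -(fineK PA) -!EFinM -EFinD lee_fin mulrDl lerD2l.
  have P1 : fine (P A) <= 1.
    by rewrite -lee_fin fineK// probability_le1.
  have P0 : 0 <= fine (P A) by rewrite fine_ge0.
  by rewrite (le_trans _ (ltW ne))// ler_piMr.
Qed.

Lemma cond_prob_le_ge1 (E : set T) (c : R) : 1 <= c -> cond_prob_le P G E c%:E.
Proof.
move=> c1; apply/cond_prob_leP; exists setT; split=> // A GA.
rewrite setIT -[leLHS]mul1e lee_wpmul2r// lee_fin//.
Qed.

End cond_prob_bounds.

(** * Maximal inequality for supermartingales *)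

Definition exceed (L : R -> T -> R) (c : R) (ts : seq R) : set T :=
  [set w | has (fun t => c <= L t w) ts].

Section maximal_inequality.
Variables (k : time_kind) (F : R -> set (set T)).
Hypothesis hF : is_filtration k P F.
Variable L : R -> T -> R.
Hypothesis superL : supermartingale k P F L.
Hypothesis L_ge0 : forall t, times k t -> {ae P, forall w, 0 <= L t w}.

Let F_sigma t : times0 k t -> sigma_algebra setT (F t).
Proof. by case: hF => + _ _ => /[apply] -[]. Qed.

Let F_measurable t : times0 k t -> F t `<=` measurable.
Proof. by case: hF => + _ _ => /[apply] -[]. Qed.

Let F_setD t A B : times0 k t -> F t A -> F t B -> F t (A `\` B).
Proof.
move=> /F_sigma h; rewrite -(measurable_g_measurableTypeE h); exact: measurableD.
Qed.

Lemma supermartingale_integral s t A : times0 k s -> times0 k t -> s <= t ->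
  F s A -> (\int[P]_(w in A) (L t w)%:E <= \int[P]_(w in A) (L s w)%:E)%E.
Proof.
move=> ks kt st FA; have [_ iL /(_ s t ks kt st)[Y [_ iY YE] YL]] := superL.
have mA := F_measurable ks FA.
rewrite -YE//; apply: ae_le_integral => //.
- exact: (integrableS measurableT).
- by apply: (integrableS measurableT) => //; exact: iL.
Qed.

Let F_exceed1 c t : times0 k t -> F t [set w | c <= L t w].
Proof.
move=> kt; have [aL _ _] := superL.
have := aL _ kt `[c, +oo[%classic (measurable_itv _).
by congr (F _ _); apply/seteqP; split=> w /=; rewrite in_itv/= andbT.
Qed.

Let exceed_cons c t (ts : seq R) :
  exceed L c (t :: ts) = [set w | c <= L t w] `|` exceed L c ts.
Proof. by apply/seteqP; split=> w /= => [/orP|/orP]. Qed.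

Let measurable_exceed c (ts : seq R) : (forall t, t \in ts -> times0 k t) ->
  measurable (exceed L c ts).
Proof.
elim: ts => [_|t ts IH kts].
  by rewrite (_ : exceed L c [::] = set0)//; apply/seteqP; split.
rewrite exceed_cons; apply: measurableU.
  by have kt := kts _ (mem_head _ _); apply: (F_measurable kt); exact: F_exceed1.
by apply: IH => u uts; apply: kts; rewrite inE uts orbT.
Qed.

(** [L_ge0] covers positive times only. Time 0 is reached through a later time, since integrals over
    a set of [F s] do not increase after [s]. *)
Lemma supermartingale_integral_ge0 s A : times0 k s -> F s A ->
  (0 <= \int[P]_(w in A) (L s w)%:E)%E.
Proof.
move=> ks FA; have mA := F_measurable ks FA.
have ks1 : times k (s + 1).
  case: k ks => /= -[->|].
  - by exists 1%N => //; rewrite add0r.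
  - by move=> [n _ ->]; exists n.+1 => //; rewrite -addn1 natrD.
  - by rewrite add0r.
  - by move=> s0; rewrite addr_gt0.
apply: le_trans (supermartingale_integral ks _ _ FA); last 2 first.
- by right; exact: ks1.
- by rewrite lerDl.
have [_ iL _] := superL.
rewrite -(integral0 P A); apply: ae_le_integral => //.
- exact: integrable0.
- by apply: (integrableS measurableT) => //; apply: iL; right.
- by apply: filterS (L_ge0 ks1) => w; rewrite lee_fin.
Qed.

(** Induction on the list, with [s] and [A] varying. At the first time [t], the part of [A] where c
    <= L t pays for itself; the rest belongs to [F t] and is handled by induction from [t]. *)
Lemma maximal_inequality_finite c s (ts : seq R) A : times0 k s ->
  (forall t, t \in ts -> times0 k t) -> path <=%R s ts -> F s A ->
  (c%:E * P (A `&` exceed L c ts) <= \int[P]_(w in A) (L s w)%:E)%E.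
Proof.
elim: ts s A => [|t ts IH] s A ks kts.
  move=> _ FA; rewrite (_ : exceed _ _ _ = set0); last by apply/seteqP; split.
  by rewrite setI0 measure0 mule0; exact: supermartingale_integral_ge0.
rewrite [path _ _ _]/= => /andP[st pts] FA.
have kt : times0 k t by apply: kts; rewrite mem_head.
have kts' u : u \in ts -> times0 k u by move=> uts; apply: kts; rewrite inE uts orbT.
have FtA : F t A by case: hF => _ Fmono _; exact: (Fmono s t ks kt st).
have mA := F_measurable ks FA.
pose B := [set w | c <= L t w].
have FB : F t B := F_exceed1 c kt.
have mB := F_measurable kt FB.
apply: le_trans (supermartingale_integral ks kt st FA).
rewrite -[X in (_ <= integral _ X _)%E](setUIDK A B).
have [_ iL _] := superL.
have iLA D : measurable D -> P.-integrable D (EFin \o L t).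
  by move=> mD; apply: (integrableS measurableT) => //; exact: iL.
have mAB : measurable (A `&` B) by exact: measurableI.
have mAD : measurable (A `\` B) by exact: measurableD.
rewrite integral_setU//; last 2 first.
- have /iLA/integrableP[] : measurable (A `&` B `|` A `\` B) by exact: measurableU.
  by [].
- by apply/disj_setPS => w [[_ Bw] []].
have IHB := IH t (A `\` B) kt kts' pts (F_setD kt FtA FB).
have leB : (c%:E * P (A `&` B) <= \int[P]_(w in A `&` B) (L t w)%:E)%E.
  rewrite -integral_cst//; apply: le_integral => //.
  - exact: finite_measure_integrable_cst.
  - exact: iLA.
  - by move=> w; rewrite inE => -[_ Bw]; rewrite lee_fin.
apply: le_trans (leeD leB IHB).
rewrite exceed_cons -/B.
have mE := measurable_exceed c kts'.
have mDE : measurable ((A `\` B) `&` exceed L c ts) by exact: measurableI.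
rewrite -ge0_muleDr// -measureU//.
  by rewrite le_eqVlt; apply/orP; left; apply/eqP; congr (_ * P _)%E;
    apply/seteqP; split=> w; rewrite /setU /setI /setD/=; have := pselect (B w); tauto.
by apply/seteqP; split=> w // [[_ Bw] [[]]].
Qed.

Lemma ville_inequality (l0 c : R) (q : nat -> R) : 0 < c ->
  (forall n, times k (q n)) -> {ae P, forall w, L 0 w <= l0} ->
  cond_prob_le P (F 0) [set w | exists n, c <= L (q n) w] (l0 / c)%:E.
Proof.
move=> c0 kq Ll0.
have k0 : times0 k (0 : R) by left.
(* The first [n] times are sorted, as the finite inequality needs increasing times; continuity of
   [P] from below then gives all of them. *)
pose ts n := sort <=%R [seq q i | i <- iota 0 n].
have tsE n t : t \in ts n -> exists2 i, (i < n)%N & t = q i.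
  by rewrite mem_sort => /mapP[i]; rewrite mem_iota add0n => /= ? ->; exists i.
have mE n : measurable (exceed L c (ts n)).
  by apply: measurable_exceed => t /tsE[i _ ->]; right.
have E_bigcup : [set w | exists n, c <= L (q n) w] = \bigcup_n exceed L c (ts n).
  apply/seteqP; split=> [w [n qn]|w [n _ /hasP[t /tsE[i _ ->] ?]]]; last by exists i.
  exists n.+1 => //; apply/hasP; exists (q n) => //.
  by rewrite mem_sort; apply: map_f; rewrite mem_iota add0n ltnSn.
apply/(cond_prob_leP (F_sigma k0) (F_measurable k0)).
exists [set w | exists n, c <= L (q n) w]; split=> //.
  by rewrite E_bigcup; exact: bigcupT_measurable.
move=> A FA; have mA := F_measurable k0 FA.
rewrite E_bigcup setI_bigcupr.
have mAE n : measurable (A `&` exceed L c (ts n)) by exact: measurableI.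
have cvgP : P \o (fun n => A `&` exceed L c (ts n)) @ \oo -->
    P (\bigcup_n (A `&` exceed L c (ts n))).
  apply: nondecreasing_cvg_mu => //; first exact: bigcupT_measurable.
  move=> m n mn; apply/subsetPset => w [Aw /hasP[t /tsE[i im ->] cL]]; split=> //.
  apply/hasP; exists (q i) => //; rewrite mem_sort; apply: map_f.
  by rewrite mem_iota add0n (leq_trans im).
rewrite -(cvg_lim _ cvgP)//; apply: lime_le.
  by apply/cvg_ex; eexists; exact: cvgP.
apply: nearW => n /=.
have [_ iL _] := superL.
have : (c%:E * P (A `&` exceed L c (ts n)) <= l0%:E * P A)%E.
  apply: (@le_trans _ _ (\int[P]_(w in A) (L 0 w)%:E)%E).
    apply: maximal_inequality_finite => //.
      by move=> t /tsE[i _ ->]; right.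
    have ts0 : all (>= 0) (ts n).
      apply/allP => t /tsE[i _ ->].
      by case: k (kq i) => /= [[j _ ->]|/ltW].
    by rewrite path_min_sorted//; exact: sort_le_sorted.
  rewrite -integral_cst//; apply: ae_le_integral => //.
  - by apply: (integrableS measurableT) => //; exact: iL.
  - exact: finite_measure_integrable_cst.
have Pfin D : measurable D -> P D \is a fin_num by move=> ?; exact: fin_num_measure.
rewrite -(fineK (Pfin _ mA)) -(fineK (Pfin _ (mAE n))) -!EFinM !lee_fin => h.
by rewrite mulrAC ler_pdivlMr// mulrC.
Qed.

End maximal_inequality.
End conditional_bounds.

(** * Line crossing for sub-psi processes *)

Section line_crossing.
Context d (T : measurableType d) (R : realType) (P : probability T R).
Variables (k : time_kind) (F : R -> set (set T)).
Hypothesis hF : is_filtration k P F.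

Let k0 : times0 k (0 : R).
Proof. by left. Qed.

Let F0_sigma : sigma_algebra setT (F 0).
Proof. by case: hF => + _ _ => /(_ _ k0) []. Qed.

Let F0_measurable : F 0 `<=` measurable.
Proof. by case: hF => + _ _ => /(_ _ k0) []. Qed.

(** This allows optimising over parameters when the optimum is not attained: the target bound plus
    any e > 0 equals l0 exp(- y) for some y < z, also for z = +oo, where the target is 0. *)
Lemma cond_prob_le_exp (E : set T) (l0 : R) (z : \bar R) : 0 < l0 -> z != -oo%E ->
  (forall y : R, (y%:E < z)%E -> cond_prob_le P (F 0) E (l0 * expR (- y))%:E) ->
  cond_prob_le P (F 0) E (l0%:E * expeR (- z))%E.
Proof.
move=> l0_gt0 zNy Ey.
have bound (c : R) : 0 <= c ->
    (forall e, 0 < e -> ((- ln ((c + e) / l0))%:E < z)%E) ->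
    cond_prob_le P (F 0) E c%:E.
  move=> c0 cz; apply: cond_prob_le_inf => // e e0.
  have ce : 0 < (c + e) / l0 by rewrite divr_gt0// ltr_wpDl.
  have -> : c + e = l0 * expR (- - ln ((c + e) / l0)).
    by rewrite opprK lnK ?posrE// mulrCA mulfV ?mulr1// gt_eqF.
  exact/Ey/cz.
case: z zNy {Ey} bound => [r _| _|] // bound.
  rewrite /= -EFinM; apply: bound => [|e e0].
    by rewrite mulr_ge0// ?expR_ge0// ltW.
  have re : 0 < l0 * expR (- r) + e by rewrite addr_gt0// mulr_gt0// expR_gt0.
  rewrite lte_fin ltrNl -ltr_expR lnK ?posrE ?divr_gt0//.
  by rewrite ltr_pdivlMr// mulrC ltrDl.
by rewrite /= mule0; apply: bound => // e _; rewrite ltry.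
Qed.

Lemma times_dense_seq : exists q : nat -> R, (forall n, times k (q n)) /\
  match k with
  | Discrete => forall t : R, times k t -> exists n, q n = t
  | Continuous => forall t e : R, 0 <= t -> 0 < e -> exists n, t < q n < t + e
  end.
Proof.
case: k; first by exists (fun n => n.+1%:R); split=> [n|t [[//|n] _ ->]];
  [exists n.+1|exists n].
(* The default 1 replaces nonpositive rationals and invalid codes, so that every term is a positive
   time. *)
pose q n : R := if (unpickle n : option rat) is Some r then
  if 0 < r then ratr r else 1 else 1.
exists q; split=> [n|t e t0 e0].
  rewrite /q /=; case: unpickle => [r|//]; case: ifPn => // r0.
  by rewrite ltr0q.
have [r] : exists r : rat, ratr r \in `]t, t + e[.
  by apply: rat_in_itvoo; rewrite ltrDl.
rewrite in_itv/= => /andP[tr rte]; exists (pickle r).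
rewrite /q pickleK -(ltr0q R) (le_lt_trans t0 tr).
by rewrite tr.
Qed.

(** One null set serves all [t]. In continuous time, right-continuity gives a common right
    neighbourhood of [t] for [S] and [V], and it contains a sampled time. *)
Lemma sampling (S V : R -> T -> R) : admissible_pairs k P F (S, V) ->
  exists q : nat -> R, (forall n, times k (q n)) /\
  {ae P, forall w, forall t e, times k t -> 0 < e ->
    exists n, `|S (q n) w - S t w| < e /\ `|V (q n) w - V t w| < e}.
Proof.
move=> [_ _ _ /= cadSV]; have [q [kq q_dense]] := times_dense_seq.
exists q; split=> //; move: cadSV kq q_dense.
case: k => [_ _ q_all|/(_ erefl)[cadS cadV] kq q_dense].
  apply: aeW => w t e /q_all[n <-] e0; exists n.
  by rewrite !subrr normr0.
apply: filterS2 cadS cadV => w [rcS _] [rcV _] t e /= t0 e0.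
have /cvgrPdist_lt/(_ e e0) hS := rcS t (ltW t0).
have /cvgrPdist_lt/(_ e e0) hV := rcV t (ltW t0).
have [r /= r0 hr] : \forall s \near t^'+, `|S t w - S s w| < e /\ `|V t w - V s w| < e.
  by near=> s; split; near: s.
have [n /andP[tq qt]] := q_dense t r (ltW t0) r0.
exists n; rewrite !(distrC _ (_ t w)); apply: hr => //=.
by rewrite distrC gtr0_norm ?subr_gt0// ltrBlDl.
Unshelve. all: by end_near. Qed.

(** Admissibility gives a null set for each time; only the countably many sampled ones are
    united. *)
Lemma variance_ge0 (S V : R -> T -> R) : admissible_pairs k P F (S, V) ->
  {ae P, forall w, forall t, times k t -> 0 <= V t w}.
Proof.
move=> SV; have [q [kq hq]] := sampling SV; have [_ _ V0 _] := SV.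
have := ae_foralln (fun n => V0 (q n) (kq n)).
apply: filterS2 hq => w hq Vq t kt.
apply/ler_addgt0Pl => e e0; have [n [_]] := hq t e kt e0.
move: (Vq n) => /=; rewrite ltr_distl => Vn /andP[_ VV].
by lra.
Qed.

Variables (lmax : \bar R) (psi : R -> R) (l0 : R).
Hypothesis hl0 : 1 <= l0.

Let l0_gt0 : 0 < l0.
Proof. exact: lt_le_trans hl0. Qed.

Lemma sub_psi_line_crossing (S V : R -> T -> R) (a a' b l : R) :
  sub_psi_class k P F lmax psi l0 (S, V) -> 0 < b -> a' < a ->
  0 < l -> (l%:E < lmax)%E -> psi l / l <= b ->
  cond_prob_le P (F 0) [set w | exists2 t, times k t & S t w >= a + b * V t w]
    (l0 * expR (- (l * a')))%:E.
Proof.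
move=> [SV subSV] b0 aa' l_gt0 lmx lb.
have [|L [superL L0 /= eL]] := subSV l; first by split=> //; exact: ltW.
have [q [kq hq]] := sampling SV.
have L_ge0 t : times k t -> {ae P, forall w, 0 <= L t w}.
  by move=> /eL; apply: filterS => w; exact/le_trans/expR_ge0.
have := ville_inequality hF superL L_ge0 (expR_gt0 (l * a')) kq L0.
rewrite -expRN; apply: (cond_prob_le_ae _ _ _ (lexx _)) => //.
have V0 := variance_ge0 SV.
have eLq := ae_foralln (fun n => eL (q n) (kq n)).
apply: filterS3 hq V0 eLq => w hq V0 eLq /= [t kt St].
have b1 : 0 < 1 + b by rewrite addr_gt0.
(* An error [e] in both [S] and [V] changes S - b V by at most (1 + b) e, which is the available
   slack a - a'. *)
have [|n [Sn Vn]] := hq t ((a - a') / (1 + b)) kt; first by rewrite divr_gt0// subr_gt0.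
exists n; apply: le_trans (eLq n); rewrite ler_expR.
have Vn0 := V0 _ (kq n).
have h : a' <= S (q n) w - b * V (q n) w.
  move: Sn Vn; set e := _ / _; rewrite !ltr_distl => /andP[Sn _] /andP[_ Vn].
  have eE : e * (1 + b) = a - a' by rewrite /e divfK// gt_eqF.
  have bV : b * V (q n) w <= b * (V t w + e) by rewrite ler_pM2l// ltW.
  move: eE bV; rewrite !mulrDr mulr1 (mulrC b e) => eE bV.
  by lra.
have lb' : psi l <= b * l by rewrite -ler_pdivrMr.
have := ler_wpM2l (ltW l_gt0) h.
have := ler_wpM2r Vn0 lb'.
rewrite mulrBr mulrA (mulrC l b); lra.
Qed.

Lemma sub_psi_line_crossing_a :
  line_crossing_a k P F lmax psi l0 (sub_psi_class k P F lmax psi l0).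
Proof.
move=> a b a0 b0 S V SV.
have D_ge0 : (0 <= Dtransf lmax psi b)%E by apply: ereal_sup_ubound; left.
apply: cond_prob_le_exp => // [|y].
  by rewrite gt_eqF// (lt_le_trans ltNy0)// mule_ge0// lee_fin ltW.
rewrite -lte_pdivrMl// => /ereal_sup_gt[_ [->|[l [l_gt0 lmx lb] <-]]].
  (* The adjoined point 0 of the supremum leaves only y < 0, where the bound is at least 1. *)
  rewrite -EFinM lte_fin pmulr_rlt0 ?invr_gt0// => y0; apply: cond_prob_le_ge1 => //.
  by rewrite -[leLHS]mul1r ler_pM// -expR0 ler_expR oppr_ge0 ltW.
rewrite -EFinM lte_fin ltr_pdivrMl// => yal.
have -> : y = l * (y / l) by rewrite mulrC divfK ?gt_eqF.
apply: (sub_psi_line_crossing SV b0 _ l_gt0 lmx lb).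
by rewrite ltr_pdivrMr.
Qed.

End line_crossing.

(** * Legendre transform of a CGF-like function *)

Section cgf_like_theory.
Context (R : realType) (lmax : \bar R) (psi : R -> R).
Hypothesis cgf : cgf_like lmax psi.

Local Notation dpsi := (psi^`()%classic).

(** * Tangents and monotonicity of the derivative *)

Definition inner_dom : set R := [set l | 0 < l /\ (l%:E < lmax)%E].

Lemma inner_dom_psi_dom l : inner_dom l -> psi_dom lmax l.
Proof. by move=> [/ltW]. Qed.

Lemma inner_dom_le l l' : 0 < l' -> l' <= l -> psi_dom lmax l -> inner_dom l'.
Proof.
by move=> l'0 ll' [_ lm]; split=> //; apply: le_lt_trans lm; rewrite lee_fin.
Qed.

Lemma inner_dom_up l : psi_dom lmax l -> exists2 l', inner_dom l' & l < l'.
Proof.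
move=> [l0]; rewrite /inner_dom; case: lmax => [r||] //=.
  rewrite lte_fin => lr; exists ((l + r) / 2) => /=; rewrite ?lte_fin; lra.
by move=> _; exists (l + 1) => /=; rewrite ?ltry; [split=> //; lra|lra].
Qed.

(** For 0 < t < 1, convexity bounds (psi (l + t (z - l)) - psi l) / t by psi z - psi l; the left
    side tends to psi' l (z - l) as [t] tends to 0. *)
Lemma tangent_le l z : inner_dom l -> psi_dom lmax z ->
  dpsi l * (z - l) <= psi z - psi l.
Proof.
move=> Il Iz; have [convex smooth _ _ _] := cgf.
have [->|zl] := eqVneq z l; first by rewrite !subrr mulr0.
have [dl _ _] := smooth l Il.1 Il.2.
have v0 : z - l != 0 by rewrite subr_eq0.
rewrite leNgt; apply/negP => lt_tangent.
have : (fun h => h^-1 *: (psi (h + l) - psi l)) @ 0^' --> dpsi l.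
  by rewrite derive1E; move: dl; rewrite /derivable /derive;
    under eq_fun do rewrite [_%:A]mulr1.
move=> /cvgrPdist_lt /(_ ((dpsi l * (z - l) - (psi z - psi l)) / `|z - l|)).
have e_gt0 : 0 < (dpsi l * (z - l) - (psi z - psi l)) / `|z - l|.
  by rewrite divr_gt0 ?subr_gt0// normr_gt0.
move=> /(_ e_gt0) [r /= r0 hr].
(* Small enough for convexity (t < 1) and for the estimate of the difference quotient (t |z - l| <
   r). *)
pose t := Num.min (1 / 2) (r / `|z - l| / 2).
have t01 : 0 < t < 1.
  rewrite /t lt_min gt_min divr_gt0//= divr_gt0 ?divr_gt0 ?normr_gt0//=.
  by apply/orP; left; lra.
have /andP[t0 t1] := t01.
have th : t * `|z - l| < r.
  rewrite -ltr_pdivlMr ?normr_gt0// (@le_lt_trans _ _ (r / `|z - l| / 2))//.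
    by rewrite /t ge_min lexx orbT.
  have : 0 < r / `|z - l| by rewrite divr_gt0// normr_gt0.
  by move: (r / _) => s; lra.
have /hr : ball_ [eta Num.norm] 0 r (t * (z - l)).
  by rewrite /ball_/= sub0r normrN normrM (gtr0_norm t0).
have tv0 : t * (z - l) != 0 by rewrite mulf_neq0// gt_eqF.
move=> /(_ tv0); rewrite ltr_pdivlMr ?normr_gt0// -normrM => hlt.
have := convex z l t Iz (inner_dom_psi_dom Il) zl t01.
rewrite (_ : t * z + (1 - t) * l = t * (z - l) + l); last by ring.
move=> cvx; have := le_lt_trans (ler_norm _) hlt.
rewrite mulrBl.
have -> : (t * (z - l))^-1 *: (psi (t * (z - l) + l) - psi l) * (z - l) =
    (psi (t * (z - l) + l) - psi l) / t.
  by rewrite /GRing.scale/=; field; rewrite v0 gt_eqF.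
rewrite ltrD2l ltrN2 ltr_pdivlMr//; lra.
Qed.

(** The weak inequality at the midpoint of [l] and [z], combined with strict convexity there. *)
Lemma tangent_lt l z : inner_dom l -> psi_dom lmax z -> z != l ->
  dpsi l * (z - l) < psi z - psi l.
Proof.
move=> Il Iz zl; have [convex _ _ _ _] := cgf.
have t12 : 0 < (1 / 2 : R) < 1 by apply/andP; split; lra.
have := convex z l (1 / 2) Iz (inner_dom_psi_dom Il) zl t12.
set y := (X in psi X).
have Iy : psi_dom lmax y.
  have [l0 lm] := Il; have [z0 zm] := Iz.
  split; first by rewrite /y; lra.
  rewrite /y; have [lz|zl'] := leP l z.
    by apply: le_lt_trans zm; rewrite lee_fin; lra.
  by apply: le_lt_trans lm; rewrite lee_fin; lra.
have := tangent_le Il Iy.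
rewrite (_ : y - l = (z - l) / 2); last by rewrite /y; field.
rewrite mulrA; lra.
Qed.

Lemma dpsi_lt l l' : inner_dom l -> inner_dom l' -> l < l' -> dpsi l < dpsi l'.
Proof.
move=> Il Il' ll'; have ll'0 : 0 < l' - l by rewrite subr_gt0.
have := tangent_lt Il (inner_dom_psi_dom Il') (negbT (gt_eqF ll')).
have := tangent_lt Il' (inner_dom_psi_dom Il) (negbT (lt_eqF ll')).
by move=> h1 h2; rewrite -(ltr_pM2r ll'0); lra.
Qed.

Lemma dpsi_lt_bbar l : inner_dom l -> ((dpsi l)%:E < bbar lmax psi)%E.
Proof.
move=> Il; have [l' Il' ll'] := inner_dom_up (inner_dom_psi_dom Il).
apply: (@lt_le_trans _ _ (dpsi l')%:E); first by rewrite lte_fin dpsi_lt.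
by apply: ereal_sup_ubound; exists l'.
Qed.

Lemma psi_dom0 l : inner_dom l -> psi_dom lmax 0.
Proof. by move=> [l0 lm]; split=> //; apply: lt_trans lm; rewrite lte_fin. Qed.

Lemma ratio_lt_dpsi l : inner_dom l -> psi l / l < dpsi l.
Proof.
move=> Il; have [l0 _] := Il; have [_ _ psi0 _ _] := cgf.
have h := tangent_lt Il (psi_dom0 Il) (negbT (lt_eqF l0)).
by rewrite ltr_pdivrMr//; move: h; rewrite psi0; lra.
Qed.

(** * Secant slopes from the origin *)

Lemma ratio_lt l l' : 0 < l -> inner_dom l' -> l < l' -> psi l / l < psi l' / l'.
Proof.
move=> l0 Il' ll'; have [convex _ psi0 _ _] := cgf.
have l'0 : 0 < l' by case: Il'.
have t01 : 0 < l / l' < 1 by rewrite divr_gt0//= ltr_pdivrMr// mul1r.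
have := convex l' 0 (l / l') (inner_dom_psi_dom Il') (psi_dom0 Il') _ t01.
rewrite mulr0 psi0 mulr0 !addr0 divfK ?gt_eqF// => /(_ isT) h.
by rewrite ltr_pdivrMr//; apply: (lt_le_trans h); rewrite mulrAC [leRHS]mulrC mulrA.
Qed.

Lemma ratio_near0 e : 0 < e -> exists2 r, 0 < r &
  forall l, 0 < l -> l < r -> `|psi l / l| < e.
Proof.
move=> e0; have [_ _ psi0 cvg0 _] := cgf.
have [r /= r0 hr] : \forall h \near 0^'+, `|0 - (psi h - psi 0) / h| < e.
  by move/cvgrPdist_lt : cvg0; apply.
exists r => // l l0 lr; have := hr l _ l0.
by rewrite psi0 !sub0r subr0 !normrN; apply; rewrite /= sub0r normrN gtr0_norm.
Qed.

(** The ratio increases strictly and tends to 0 at 0: a negative value would keep it away from 0 on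
    its left. Comparison with l / 2 makes the inequality strict. *)
Lemma ratio_gt0 l : inner_dom l -> 0 < psi l / l.
Proof.
move=> Il; have [l0 lm] := Il.
have ratio_ge0 l' : inner_dom l' -> 0 <= psi l' / l'.
  move=> Il'; rewrite leNgt; apply/negP => neg.
  have [|r r0 hr] := @ratio_near0 (- (psi l' / l')); first by rewrite oppr_gt0.
  have l'0 : 0 < l' by case: Il'.
  pose h := Num.min (l' / 2) (r / 2).
  have h0 : 0 < h by rewrite lt_min !divr_gt0.
  have hl : h < l' by rewrite gt_min; apply/orP; left; lra.
  have hr' : h < r by rewrite gt_min; apply/orP; right; lra.
  have := hr h h0 hr'; have := ratio_lt h0 Il' hl.
  move=> h1; rewrite ltr_norml => /andP[h2 h3]; lra.
have l20 : 0 < l / 2 by rewrite divr_gt0.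
have Il2 : inner_dom (l / 2).
  by apply: inner_dom_le (inner_dom_psi_dom Il) => //; lra.
by apply: le_lt_trans (ratio_ge0 _ Il2) _; apply: ratio_lt => //; lra.
Qed.

Lemma dpsi_gt0 l : inner_dom l -> 0 < dpsi l.
Proof. by move=> Il; exact: lt_trans (ratio_gt0 Il) (ratio_lt_dpsi Il). Qed.

(** * Ranges of the derivative and of the secant slope *)

Hypothesis lmax_gt0 : (0 < lmax)%E.

Lemma ratio_small e : 0 < e -> exists2 l, inner_dom l & psi l / l < e.
Proof.
move=> /ratio_near0[r r0 hr].
have [|l' [l'0 Il'] _] := @inner_dom_up 0; first by split.
pose h := Num.min l' (r / 2).
have h0 : 0 < h by rewrite lt_min l'0 divr_gt0.
exists h.
  split=> //; apply: le_lt_trans Il'; by rewrite lee_fin ge_min lexx.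
apply: le_lt_trans (ler_norm _) _; apply: hr => //.
by rewrite gt_min; apply/orP; right; lra.
Qed.

Lemma dpsi_small e : 0 < e -> exists2 l, inner_dom l & dpsi l < e.
Proof.
(* The tangent at l / 2 gives psi' (l / 2) <= psi l / (l / 2), twice the ratio at [l]; hence e /
   2. *)
move=> e0; have [|l Il lt_e] := @ratio_small (e / 2); first by rewrite divr_gt0.
have [l0 _] := Il.
have l20 : 0 < l / 2 by rewrite divr_gt0.
have ll2 : l / 2 <= l by lra.
have Il2 := inner_dom_le l20 ll2 (inner_dom_psi_dom Il).
exists (l / 2) => //.
have := tangent_le Il2 (inner_dom_psi_dom Il).
have := ratio_gt0 Il2; rewrite pmulr_lgt0 ?invr_gt0// => psi2 h.
move: lt_e; rewrite ltr_pdivrMr// => lt_e.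
rewrite -(ltr_pM2r l20); lra.
Qed.

Lemma dpsi_within_continuous l1 l2 : inner_dom l1 -> inner_dom l2 ->
  {within `[l1, l2], continuous dpsi}.
Proof.
move=> [l10 _] [_ l2m]; have [_ smooth _ _ _] := cgf.
apply: derivable_within_continuous => x; rewrite in_itv/= => /andP[l1x xl2].
have [|] := smooth x (lt_le_trans l10 l1x) => //.
by apply: le_lt_trans l2m; rewrite lee_fin.
Qed.

Lemma dpsi_ivt l1 l2 u : inner_dom l1 -> inner_dom l2 -> l1 <= l2 ->
  dpsi l1 <= u <= dpsi l2 ->
  exists l, [/\ inner_dom l, l1 <= l <= l2 & dpsi l = u].
Proof.
move=> Il1 Il2 l12 /andP[u1 u2].
have [|l] := IVT l12 (dpsi_within_continuous Il1 Il2) (v := u).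
  by rewrite ge_min u1 le_max u2 orbT.
rewrite in_itv/= => /andP[l1l ll2] <-; exists l; split=> //; last by rewrite l1l.
apply: inner_dom_le (inner_dom_psi_dom Il2) => //.
by case: Il1 => + _; move/lt_le_trans; apply.
Qed.

Lemma dpsi_surj u : 0 < u -> (u%:E < bbar lmax psi)%E ->
  exists2 l, inner_dom l & dpsi l = u.
Proof.
move=> u0 /ereal_sup_gt[_ [l2 Il2 <-]]; rewrite lte_fin => u2.
have [l1 Il1 u1] := dpsi_small u0.
have l12 : l1 <= l2.
  rewrite leNgt; apply/negP => l21; have := dpsi_lt Il2 Il1 l21.
  by rewrite ltNge (ltW (lt_trans u1 u2)).
by have [|l [Il _ <-]] := dpsi_ivt (u := u) Il1 Il2 l12; [rewrite !ltW|exists l].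
Qed.

(** If [lmax] is infinite, a tangent of slope above [b] eventually overtakes the line of slope [b]
    through the origin. If [lmax] is finite, [psi] is unbounded on a bounded domain. *)
Lemma ratio_large b : 0 < b -> (b%:E < bbar lmax psi)%E ->
  exists2 l, inner_dom l & b < psi l / l.
Proof.
move=> b0 /ereal_sup_gt[_ [l Il <-]]; rewrite lte_fin => bl.
have [_ _ psi0 _ sup_psi] := cgf.
have [l0 lm] := Il.
have [lmaxy|] := eqVneq lmax +oo%E.
  have I x : 0 < x -> inner_dom x by move=> x0; split=> //; rewrite lmaxy ltry.
  pose c := dpsi l * l - psi l.
  have c0 : 0 < c by have := ratio_lt_dpsi Il; rewrite ltr_pdivrMr// subr_gt0.
  have d0 : 0 < dpsi l - b by rewrite subr_gt0.
  (* The tangent at [l] meets that line at c / (dpsi l - b); adding [l] goes strictly beyond. *)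
  pose x := l + c / (dpsi l - b).
  have x0 : 0 < x by rewrite addr_gt0// divr_gt0.
  exists x; first exact: I.
  rewrite ltr_pdivlMr//.
  have cd0 : 0 < c / (dpsi l - b) by rewrite divr_gt0.
  have lx : x != l by rewrite /x -subr_eq0 addrAC subrr add0r gt_eqF.
  have := tangent_lt Il (inner_dom_psi_dom (I _ x0)) lx.
  have : (dpsi l - b) * (x - l) = c.
    by rewrite /x; field; rewrite gt_eqF.
  have : 0 < (dpsi l - b) * l by rewrite mulr_gt0.
  rewrite /c; lra.
move=> lmaxNy.
have [r lmaxr] : exists r, lmax = r%:E.
  by case: lmax lm lmaxNy => [r||]// _ _; exists r.
have : ((Num.max 0 (b * r))%:E < +oo)%E by rewrite ltry.
rewrite -sup_psi => /ereal_sup_gt[_ [x [x0 xm] <-]].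
rewrite lte_fin gt_max => /andP[px brx].
have xpos : 0 < x.
  by rewrite lt_neqAle x0 andbT; apply/eqP => x00; move: px; rewrite -x00 psi0 ltxx.
exists x; first by split.
rewrite ltr_pdivlMr//; apply: le_lt_trans brx.
by rewrite ler_pM2l//; move: xm; rewrite lmaxr lte_fin => /ltW.
Qed.

Lemma ratio_surj b : 0 < b -> (b%:E < bbar lmax psi)%E ->
  exists2 l, inner_dom l & psi l / l = b.
Proof.
move=> b0 bbar_b; have [l1 Il1 b1] := ratio_small b0.
have [l2 Il2 b2] := ratio_large b0 bbar_b.
have l12 : l1 <= l2.
  rewrite leNgt; apply/negP => l21; have := ratio_lt Il2.1 Il1 l21.
  by rewrite ltNge (ltW (lt_trans b1 b2)).
have cont : {within `[l1, l2], continuous (fun l => psi l / l)}.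
  have [_ smooth _ _ _] := cgf.
  apply: derivable_within_continuous => x; rewrite in_itv/= => /andP[l1x xl2].
  have x0 : 0 < x by apply: lt_le_trans l1x; case: Il1.
  have [|dx _ _] := smooth x x0.
    by case: Il2 => _; apply: le_lt_trans; rewrite lee_fin.
  by apply: derivableM => //; apply: derivableV => //; rewrite gt_eqF.
have [|l] := IVT l12 cont (v := b).
  by rewrite ge_min (ltW b1) le_max (ltW b2) orbT.
rewrite in_itv/= => /andP[l1l ll2] <-; exists l => //.
apply: inner_dom_le (inner_dom_psi_dom Il2) => //.
by case: Il1 => + _; move/lt_le_trans; apply.
Qed.

(** * Values of the transforms *)

Lemma psi_star_dpsi l : inner_dom l ->
  psi_star lmax psi (dpsi l) = (l * dpsi l - psi l)%:E.
Proof.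
move=> Il; apply/eqP; rewrite eq_le; apply/andP; split.
  apply: ge_ereal_sup => _ [z Iz <-]; rewrite lee_fin.
  by have := tangent_le Il Iz; lra.
by apply: ereal_sup_ubound; exists l => //; exact: inner_dom_psi_dom.
Qed.

(** The derivative of [psi_star] inverts psi'. For a small increment [h], psi' l + h = psi' l' with
    [l'] close to [l], and the tangent inequalities at [l] and [l'] enclose the difference quotient
    between [l] and [l']. *)
Lemma derive_psi_star l : inner_dom l ->
  (fun v => fine (psi_star lmax psi v))^`()%classic (dpsi l) = l.
Proof.
move=> Il; have [l0 _] := Il.
apply/cvg_lim => //; apply/cvgrPdist_lt => e e0.
have [l2 Il2 /andP[ll2 l2e]] : exists2 l2, inner_dom l2 & l < l2 < l + e.
  have [l2 Il2 ll2] := inner_dom_up (inner_dom_psi_dom Il).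
  pose m := Num.min l2 (l + e / 2).
  have lm : l < m by rewrite lt_min ll2/=; lra.
  have ml2 : m <= l2 by rewrite ge_min lexx.
  exists m; last first.
    by rewrite lm/= gt_min; apply/orP; right; lra.
  exact: inner_dom_le (lt_trans l0 lm) ml2 (inner_dom_psi_dom Il2).
have [l1 Il1 /andP[l1e l1l]] : exists2 l1, inner_dom l1 & l - e < l1 < l.
  pose m := Num.max (l / 2) (l - e / 2).
  have ml : m < l by rewrite gt_max; apply/andP; split; lra.
  have m0 : 0 < m by rewrite lt_max; apply/orP; left; lra.
  exists m; last by rewrite ml andbT lt_max; apply/orP; right; lra.
  exact: inner_dom_le m0 (ltW ml) (inner_dom_psi_dom Il).
have d1 := dpsi_lt Il1 Il l1l; have d2 := dpsi_lt Il Il2 ll2.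
(* This radius keeps dpsi l + h between dpsi l1 and dpsi l2, so that [l'] stays in ]l - e, l +
   e[. *)
apply/nbhs_ballP; exists (Num.min (dpsi l2 - dpsi l) (dpsi l - dpsi l1)) => /=.
  by rewrite lt_min !subr_gt0 d1 d2.
move=> h; rewrite -ball_normE /ball_ /= sub0r normrN lt_min !ltr_norml.
move=> /andP[/andP[_ h2] /andP[h1 _]] h0.
have [|l' [Il' /andP[l1l' l'l2] dl']] :=
    dpsi_ivt (u := h + dpsi l) Il1 Il2 (ltW (lt_trans l1l ll2)).
  by apply/andP; split; lra.
rewrite -dl' !psi_star_dpsi//= dl'.
have := tangent_le Il' (inner_dom_psi_dom Il).
have := tangent_le Il (inner_dom_psi_dom Il').
rewrite dl' => t1 t2.
rewrite /GRing.scale/=.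
set D := (X in h^-1 * X).
have D1 : l * h <= D by rewrite /D; lra.
have D2 : D <= l' * h by rewrite /D; lra.
have DE : D = h * (h^-1 * D) by rewrite mulrA mulfV// mul1r.
rewrite DE in D1 D2; move: (h^-1 * D) D1 D2 => q; rewrite ![_ * h]mulrC => D1 D2.
have [h_pos|h_neg|/eqP] := ltgtP h 0; last by rewrite (negbTE h0).
  move: D1 D2; rewrite !ler_nM2l// => D1 D2.
  by apply/andP; split; lra.
by move: D1 D2; rewrite !ler_pM2l// => D1 D2; apply/andP; split; lra.
Qed.

Lemma slope_transf_dpsi l : inner_dom l ->
  slope_transf lmax psi (dpsi l) = psi l / l.
Proof.
move=> Il; rewrite /slope_transf gt_eqF ?dpsi_gt0// lt_eqF ?dpsi_lt_bbar//.
by rewrite derive_psi_star.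
Qed.

Lemma Dtransf_ratio l : inner_dom l -> Dtransf lmax psi (psi l / l) = l%:E.
Proof.
move=> Il; have [l0 lm] := Il; apply/eqP; rewrite eq_le; apply/andP; split.
  apply: ge_ereal_sup => _ [->|[z [z0 zm zl] <-]]; rewrite lee_fin; first exact: ltW.
  rewrite leNgt; apply/negP => lz.
  by have := ratio_lt l0 (conj z0 zm) lz; rewrite ltNge zl.
by apply: ereal_sup_ubound; right; exists l.
Qed.

(** All secant slopes are below [b], so a finite lmax = r would bound [psi] by r b, against its
    supremum being infinite. *)
Lemma bbar_fin_lmax b : (bbar lmax psi <= b%:E)%E -> lmax = +oo%E.
Proof.
move=> bb; have [_ _ psi0 _ sup_psi] := cgf.
have [l0 Il0 _] := ratio_small ltr01.
case lmaxr : lmax lmax_gt0 => [r||]// r0.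
suff : (+oo <= (r * b)%:E)%E by rewrite leye_eq.
have ratio_b l : inner_dom l -> psi l / l < b.
  move=> Il; rewrite -lte_fin; apply: lt_le_trans bb.
  by apply: lt_trans (dpsi_lt_bbar Il); rewrite lte_fin ratio_lt_dpsi.
have b0 : 0 < b by apply: lt_trans (ratio_gt0 Il0) (ratio_b _ Il0).
rewrite lte_fin in r0.
rewrite -sup_psi lmaxr; apply: ge_ereal_sup => _ [z [z0 zr] <-]; rewrite lee_fin.
have [->|zN0] := eqVneq z 0; first by rewrite psi0 mulr_ge0// ltW.
have z_gt0 : 0 < z by rewrite lt_neqAle eq_sym zN0.
have Iz : inner_dom z by split=> //; rewrite lmaxr.
have := ratio_b _ Iz; rewrite ltr_pdivrMr// => /ltW/le_trans; apply.
by rewrite mulrC ler_pM2r// ltW// -lte_fin.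
Qed.

Lemma inner_dom_unbounded b l : (bbar lmax psi <= b%:E)%E -> 0 < l -> inner_dom l.
Proof. by move=> /bbar_fin_lmax h l0; split=> //; rewrite h ltry. Qed.

Lemma Dtransf_ge_bbar b : (bbar lmax psi <= b%:E)%E -> Dtransf lmax psi b = +oo%E.
Proof.
move=> bb; apply/eqyP => x x0; have Ix := inner_dom_unbounded bb x0.
apply: ereal_sup_ubound; right; exists x => //; split=> //; first by case: Ix.
rewrite -lee_fin; apply: ltW; apply: lt_le_trans bb.
by apply: lt_trans (dpsi_lt_bbar Ix); rewrite lte_fin ratio_lt_dpsi.
Qed.

(* Lower semicontinuity of the Legendre transform at the end point bbar. *)
Lemma psi_star_bbar_approx u y : u%:E = bbar lmax psi ->
  (y%:E < psi_star lmax psi u)%E ->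
  exists2 l, inner_dom l & y < l * dpsi l - psi l.
Proof.
move=> uE /ereal_sup_gt[_ [z [z0 zm] <-]]; rewrite lte_fin => yz.
(* With [e] the subtracted quotient, z (u - e) - psi z = y + e > y; dividing by z + 1 rather than by
   [z] covers z = 0. *)
have [l Il] : exists2 l, inner_dom l & u - (z * u - psi z - y) / (z + 1) < dpsi l.
  have : ((u - (z * u - psi z - y) / (z + 1))%:E < bbar lmax psi)%E.
    rewrite -uE lte_fin ltrBlDr ltrDl divr_gt0//; first by rewrite subr_gt0.
    by rewrite ltr_wpDl.
  by move=> /ereal_sup_gt[_ [l Il <-]]; rewrite lte_fin; exists l.
set e := _ / _ => dl; exists l => //.
have z1 : 0 < z + 1 by rewrite ltr_wpDl.
have eE : e * (z + 1) = z * u - psi z - y by rewrite divfK// gt_eqF.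
have e0 : 0 < e by rewrite divr_gt0// subr_gt0.
have := tangent_le Il (conj z0 zm : psi_dom lmax z).
have : z * (u - e) <= z * dpsi l by rewrite ler_wpM2l// ltW.
lra.
Qed.

End cgf_like_theory.

(** * Equivalence of the four statements *)

Section equivalences.
Context d (T : measurableType d) (R : realType) (P : probability T R).
Variables (k : time_kind) (F : R -> set (set T)).
Hypothesis hF : is_filtration k P F.
Variables (lmax : \bar R) (psi : R -> R) (l0 : R).
Hypotheses (lmax_gt0 : (0 < lmax)%E) (hl0 : 1 <= l0).
Hypothesis cgf : cgf_like lmax psi.
(** For the sub-psi class all four statements hold, which makes their equivalence trivial; it has
    content for an arbitrary class of admissible pairs. *)
Variable C : set (process_pair T R).
Hypothesis C_admissible : C `<=` admissible_pairs k P F.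

Local Notation dpsi := (psi^`()%classic).
Local Notation inner := (inner_dom lmax).

Let l0_gt0 : 0 < l0.
Proof. exact: lt_le_trans hl0. Qed.

Let F0_sigma : sigma_algebra setT (F 0).
Proof. by case: hF => + _ _ => /(_ 0 (or_introl erefl)) []. Qed.

Let F0_measurable : F 0 `<=` measurable.
Proof. by case: hF => + _ _ => /(_ 0 (or_introl erefl)) []. Qed.

Definition line_event (S V : R -> T -> R) (a b : R) : set T :=
  [set w | exists2 t, times k t & S t w >= a + b * V t w].

(* The common form of the four statements: each line is parametrised by the
   argument l at which its slope is psi l / l. *)
Definition line_crossing_inner : Prop :=
  forall a l : R, 0 < a -> inner l ->
  forall S V : R -> T -> R, C (S, V) ->
  cond_prob_le P (F 0) (line_event S V a (psi l / l)) (l0 * expR (- (l * a)))%:E.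

Lemma cond_prob_le_incl (S V : R -> T -> R) (E1 E2 : set T) (c1 c2 : R) :
  C (S, V) ->
  (forall w, (forall t, times k t -> 0 <= V t w) -> E1 w -> E2 w) -> c1 <= c2 ->
  cond_prob_le P (F 0) E2 c1%:E -> cond_prob_le P (F 0) E1 c2%:E.
Proof.
move=> /C_admissible SV E12 c12; apply: cond_prob_le_ae => //.
by have := variance_ge0 SV; apply: filterS => w; exact: E12.
Qed.

Let inner_neq0 l : inner l -> l != 0.
Proof. by move=> [l_gt0 _]; rewrite gt_eqF. Qed.

Lemma line_crossing_a_inner :
  line_crossing_a k P F lmax psi l0 C -> line_crossing_inner.
Proof.
move=> ha a l a0 Il S V SV.
have := ha a (psi l / l) a0 (ratio_gt0 cgf Il) S V SV.
by rewrite Dtransf_ratio//= -EFinM mulrC (mulrC a).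
Qed.

Lemma line_crossing_inner_a :
  line_crossing_inner -> line_crossing_a k P F lmax psi l0 C.
Proof.
move=> hi a b a0 b0 S V SV.
have [b_bbar|bbar_b] := ltP b%:E (bbar lmax psi).
  have [l Il <-] := ratio_surj cgf lmax_gt0 b0 b_bbar.
  by rewrite Dtransf_ratio//= -EFinM (mulrC a); exact: hi.
rewrite (Dtransf_ge_bbar cgf lmax_gt0 bbar_b) gt0_muley ?lte_fin//.
(* The bound to reach is 0. This [l] is positive and satisfies l a >= y, and its slope is below
   [b]. *)
apply: (cond_prob_le_exp hF) => // y _; pose l := Num.max 1 (y / a).
have l_gt0 : 0 < l by rewrite lt_max ltr01.
have Il := inner_dom_unbounded cgf lmax_gt0 bbar_b l_gt0.
have ratio_b : psi l / l <= b.
  rewrite -lee_fin; apply: ltW; apply: lt_le_trans bbar_b.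
  by apply: lt_trans (dpsi_lt_bbar cgf Il); rewrite lte_fin (ratio_lt_dpsi cgf Il).
apply: (cond_prob_le_incl SV) (hi a l a0 Il S V SV) => [w V0 [t kt St]|].
  exists t => //; apply: le_trans St.
  by rewrite lerD2l ler_wpM2r// V0.
rewrite ler_pM2l// ler_expR lerN2 -ler_pdivrMr// le_max lexx orbT //.
Qed.

Lemma line_crossing_b_inner :
  line_crossing_b k P F lmax psi l0 C -> line_crossing_inner.
Proof.
move=> hb a l a0 Il S V SV.
have r_lt_u := ratio_lt_dpsi cgf Il.
have lN0 := inner_neq0 Il.
have ur0 : 0 < dpsi l - psi l / l by rewrite subr_gt0.
(* Chosen so that the line of slope psi l / l through (m, m psi' l) has intercept [a]. *)
pose m := a / (dpsi l - psi l / l).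
have m0 : 0 < m by rewrite divr_gt0.
have u0 := dpsi_gt0 cgf Il.
have mu : m * dpsi l - m * (psi l / l) = a by rewrite -mulrBr divfK// gt_eqF.
have muM : m * dpsi l / m = dpsi l by rewrite mulrC mulKf// gt_eqF.
have := hb m (m * dpsi l) m0 (mulr_gt0 m0 u0).
rewrite EFinM lte_pmul2l ?lte_fin// => /(_ (dpsi_lt_bbar cgf Il) S V SV).
rewrite muM slope_transf_dpsi// psi_star_dpsi//= -EFinM.
apply: (cond_prob_le_incl SV) => [w _ [t kt St]|].
  by exists t => //; apply: le_trans St; rewrite -mu; lra.
rewrite ler_pM2l// ler_expR lerN2 -mu.
by rewrite le_eqVlt; apply/orP; left; apply/eqP; field.
Qed.

Lemma line_crossing_inner_b :
  line_crossing_inner -> line_crossing_b k P F lmax psi l0 C.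
Proof.
move=> hi m x m0 x0 xm S V SV.
have [|l Il lE] := dpsi_surj cgf lmax_gt0 (divr_gt0 x0 m0).
  by rewrite mulrC EFinM lte_pdivrMl.
have lN0 := inner_neq0 Il.
have xE : x = m * dpsi l by rewrite lE mulrC divfK// gt_eqF.
have a0 : 0 < m * (dpsi l - psi l / l).
  by rewrite mulr_gt0// subr_gt0 (ratio_lt_dpsi cgf Il).
rewrite -lE slope_transf_dpsi// psi_star_dpsi//= -EFinM.
apply: (cond_prob_le_incl SV) (hi _ l a0 Il S V SV) => [w _ [t kt St]|].
  by exists t => //; apply: le_trans St; rewrite xE; lra.
rewrite ler_pM2l// ler_expR lerN2.
by rewrite le_eqVlt; apply/orP; left; apply/eqP; field.
Qed.

Lemma ratio_eventE (m x s v y : R) : 0 < v ->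
  (y / v >= x - (x - s) / v * (v - m)) = (y >= m * x + s * (v - m)).
Proof.
move=> v0; rewrite ler_pdivlMr//; congr (_ <= _).
by field; rewrite gt_eqF.
Qed.

Lemma line_crossing_bc : line_crossing_b k P F lmax psi l0 C <->
  line_crossing_c k P F lmax psi l0 C.
Proof.
split=> [hb m x m0 x0 xb S V SV|hc m x m0 x0 xm S V SV].
  have [l Il lE] := dpsi_surj cgf lmax_gt0 x0 xb.
  have := hb m (m * x) m0 (mulr_gt0 m0 x0).
  rewrite EFinM lte_pmul2l ?lte_fin// => /(_ xb S V SV).
  rewrite (_ : m * x / m = x); last by rewrite mulrC mulKf// gt_eqF.
  rewrite -lE psi_star_dpsi//= -EFinM.
  apply: (cond_prob_le_incl SV) => // w V0 [t kt St]; exists t => //.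
  move: St; have [-> //|Vn0] := eqVneq (V t w) 0.
  by rewrite ratio_eventE// lt_neqAle eq_sym Vn0 V0.
have xm' : ((x / m)%:E < bbar lmax psi)%E by rewrite mulrC EFinM lte_pdivrMl.
have xm0 : 0 < x / m by rewrite divr_gt0.
have [l Il lE] := dpsi_surj cgf lmax_gt0 xm0 xm'.
have := hc m (x / m) m0 xm0 xm' S V SV.
rewrite -lE psi_star_dpsi//= -EFinM.
apply: (cond_prob_le_incl SV) => // w V0 [t kt St]; exists t => //.
have xE : m * dpsi l = x by rewrite lE mulrC divfK// gt_eqF.
have [V00|Vn0] := eqVneq (V t w) 0.
  by rewrite V00 xE -V00.
by rewrite ratio_eventE ?xE// lt_neqAle eq_sym Vn0 V0.
Qed.

Let bound_fin (z : \bar R) : z != -oo%E ->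
  exists c : R, (l0%:E * expeR (- z))%E = c%:E.
Proof.
case: z => [r _|_|//]; first by exists (l0 * expR (- r)).
by exists 0; rewrite /= mule0.
Qed.

Let Dtransf_mul_Ny a b : 0 < a -> (a%:E * Dtransf lmax psi b)%E != -oo%E.
Proof.
move=> a0; rewrite gt_eqF// (lt_le_trans ltNy0)// mule_ge0// ?lee_fin ?(ltW a0)//.
by apply: ereal_sup_ubound; left.
Qed.

(** Take m = 0: the constraint V >= m then holds almost surely at all times. *)
Lemma line_crossing_d_a :
  line_crossing_d k P F lmax psi l0 C -> line_crossing_a k P F lmax psi l0 C.
Proof.
move=> hd a b a0 b0 S V SV.
have := hd 0 a b (lexx 0) a0 b0 S V SV.
rewrite eqxx/= mule0 sube0; have [c ->] := bound_fin (Dtransf_mul_Ny b a0).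
apply: (cond_prob_le_incl SV) => // w V0 [t kt St]; exists t => //.
by split; [exact: V0|rewrite subr0].
Qed.

Let bbar_gt0 : (0 < bbar lmax psi)%E.
Proof.
have [l Il _] := ratio_small cgf lmax_gt0 ltr01.
by apply: lt_trans (dpsi_lt_bbar cgf Il); rewrite lte_fin (dpsi_gt0 cgf Il).
Qed.

Lemma line_crossing_inner_d :
  line_crossing_inner -> line_crossing_d k P F lmax psi l0 C.
Proof.
move=> hi m x b m_ge0 x0 b0 S V SV.
have ha := line_crossing_inner_a hi.
(* The line has positive intercept x - b m, so (a) applies to it, ignoring the constraint V >= m. *)
have small_slope : b * m < x ->
  cond_prob_le P (F 0)
    [set w | exists2 t, times k t & V t w >= m /\ S t w >= x + b * (V t w - m)]
    (l0%:E * expeR (- ((x%:E - b%:E * m%:E) * Dtransf lmax psi b)))%E.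
  move=> bmx; rewrite -EFinM -EFinB.
  have a0 : 0 < x - b * m by rewrite subr_gt0.
  have := ha _ _ a0 b0 S V SV; have [c ->] := bound_fin (Dtransf_mul_Ny b a0).
  apply: (cond_prob_le_incl SV) => // w _ [t kt [_ St]]; exists t => //.
  by apply: le_trans St; lra.
(* Where V >= m, the line may be lowered to pass through (m, m psi' l) with the smaller slope psi l
   / l. *)
have inner_bound l : 0 < m -> inner l -> m * dpsi l <= x -> psi l / l <= b ->
  cond_prob_le P (F 0)
    [set w | exists2 t, times k t & V t w >= m /\ S t w >= x + b * (V t w - m)]
    (l0 * expR (- (m * (l * dpsi l - psi l))))%:E.
  move=> m0 Il ux rb.
  have a0 : 0 < m * (dpsi l - psi l / l).
    by rewrite mulr_gt0// subr_gt0 (ratio_lt_dpsi cgf Il).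
  apply: (cond_prob_le_incl SV) (hi _ l a0 Il S V SV) => [w _ [t kt [Vm St]]|].
    exists t => //; apply: le_trans St.
    have : (psi l / l) * (V t w - m) <= b * (V t w - m).
      by rewrite ler_wpM2r// subr_ge0.
    lra.
  rewrite ler_pM2l// ler_expR lerN2 le_eqVlt; apply/orP; left; apply/eqP.
  by field; exact: inner_neq0.
have [m00|mN0] := eqVneq m 0.
  by move: small_slope; rewrite m00 !mule0 mulr0; apply.
have m0 : 0 < m by rewrite lt_neqAle eq_sym mN0.
have [xm|xm] := ltP (m%:E * bbar lmax psi)%E x%:E.
  have [b_bbar|bbar_b] := ltP b%:E (bbar lmax psi).
    apply: small_slope; rewrite -lte_fin; apply: lt_trans xm.
    by rewrite mulrC EFinM lte_pmul2l// lte_fin.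
  rewrite (Dtransf_ge_bbar cgf lmax_gt0 bbar_b).
  (* Where V >= m, the slope [b] may be lowered to [B], which gives the positive intercept x - B m;
     as D(B) is infinite, (a) gives the bound 0. *)
  case bbarE : (bbar lmax psi) bbar_gt0 xm bbar_b => [B||]// B0 xm Bb.
  rewrite lte_fin in B0; rewrite -EFinM lte_fin in xm; rewrite lee_fin in Bb.
  have a0 : 0 < x - B * m by rewrite subr_gt0 mulrC.
  have := ha _ _ a0 B0 S V SV.
  rewrite (Dtransf_ge_bbar cgf lmax_gt0) ?bbarE// -EFinM -EFinB.
  rewrite gt0_muley ?lte_fin//= mule0.
  apply: (cond_prob_le_incl SV) => // w _ [t kt [Vm St]]; exists t => //.
  apply: le_trans St.
  have : B * (V t w - m) <= b * (V t w - m) by rewrite ler_wpM2r// subr_ge0.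
  by lra.
have xm' : ((x / m)%:E <= bbar lmax psi)%E by rewrite mulrC EFinM lee_pdivrMl.
have xm0 : 0 < x / m by rewrite divr_gt0.
have xE : m * (x / m) = x by rewrite mulrC divfK.
move: xm'; rewrite le_eqVlt => /orP[/eqP u_bbar|u_bbar].
  have -> : slope_transf lmax psi (x / m) = x / m.
    by rewrite /slope_transf u_bbar eqxx gt_eqF.
  have [bu|ub] := ltP b (x / m).
    have /ltW/min_idPl -> : (b%:E < bbar lmax psi)%E by rewrite -u_bbar lte_fin.
    by apply: small_slope; rewrite -ltr_pdivlMr.
  apply: (cond_prob_le_exp hF) => // [|y].
    rewrite gt_eqF// (lt_le_trans ltNy0)// mule_ge0//.
    have [_ _ psi0 _ _] := cgf.
    by apply: ereal_sup_ubound; exists 0; [split|rewrite psi0 mul0r subr0].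
  (* No inner [l] has psi' l = bbar, so the end point x / m = bbar is approached from below. *)
  rewrite -lte_pdivrMl// -EFinM => /(psi_star_bbar_approx cgf u_bbar)[l Il yl].
  have ul : dpsi l < x / m by rewrite -lte_fin u_bbar; exact: (dpsi_lt_bbar cgf Il).
  apply: (cond_prob_le_incl SV) (inner_bound l m0 Il _ _) => //.
  - rewrite ler_pM2l// ler_expR lerN2.
    by rewrite -ler_pdivrMl// ltW.
  - by rewrite -xE ler_pM2l// ltW.
  - exact: ltW (lt_le_trans (lt_trans (ratio_lt_dpsi cgf Il) ul) ub).
have [l Il lE] := dpsi_surj cgf lmax_gt0 xm0 u_bbar.
rewrite -lE slope_transf_dpsi// psi_star_dpsi//.
have [bl|lb] := ltP b (psi l / l); last first.
  by rewrite /= -EFinM; apply: inner_bound => //; rewrite lE xE.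
(* Here b < s(x / m) < x / m, hence b m < x. *)
have bu := lt_trans bl (ratio_lt_dpsi cgf Il).
have /ltW/min_idPl -> : (b%:E < bbar lmax psi)%E.
  by apply: lt_trans (dpsi_lt_bbar cgf Il); rewrite lte_fin.
by apply: small_slope; rewrite -ltr_pdivlMr// -lE.
Qed.

End equivalences.

Theorem theorem1 (d : measure_display) (T : measurableType d) (R : realType)
    (k : time_kind) (P : probability T R) (F : R -> set (set T))
    (hF : is_filtration k P F)
    (lmax : \bar R) (hlmax : (0 < lmax)%E) (psi : R -> R)
    (l0 : R) (hl0 : 1 <= l0) :
  line_crossing_a k P F lmax psi l0 (sub_psi_class k P F lmax psi l0) /\
  (cgf_like lmax psi ->
     [/\ line_crossing_b k P F lmax psi l0 (sub_psi_class k P F lmax psi l0),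
         line_crossing_c k P F lmax psi l0 (sub_psi_class k P F lmax psi l0)
       & line_crossing_d k P F lmax psi l0 (sub_psi_class k P F lmax psi l0)] /\
     forall C : set (process_pair T R), C `<=` admissible_pairs k P F ->
       [/\ line_crossing_a k P F lmax psi l0 C <->
             line_crossing_b k P F lmax psi l0 C,
           line_crossing_a k P F lmax psi l0 C <->
             line_crossing_c k P F lmax psi l0 C
         & line_crossing_a k P F lmax psi l0 C <->
             line_crossing_d k P F lmax psi l0 C]).
Proof.
have a_sub := sub_psi_line_crossing_a (lmax := lmax) (psi := psi) hF hl0.
split=> // cgf.
have equiv C : C `<=` admissible_pairs k P F ->
    [/\ line_crossing_a k P F lmax psi l0 C <->
          line_crossing_b k P F lmax psi l0 C,
        line_crossing_a k P F lmax psi l0 C <->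
          line_crossing_c k P F lmax psi l0 C
      & line_crossing_a k P F lmax psi l0 C <->
          line_crossing_d k P F lmax psi l0 C].
  move=> hC.
  have ab : line_crossing_a k P F lmax psi l0 C <->
      line_crossing_b k P F lmax psi l0 C.
    split=> [ha|hb].
      apply: (line_crossing_inner_b hF hlmax hl0 cgf hC).
      exact: line_crossing_a_inner.
    apply: (line_crossing_inner_a hF hlmax hl0 cgf hC).
    exact: (line_crossing_b_inner hF hl0 cgf hC).
  have bc : line_crossing_b k P F lmax psi l0 C <->
      line_crossing_c k P F lmax psi l0 C.
    exact: line_crossing_bc.
  split=> //; first by split=> [/ab/bc|/bc/ab].
  split=> [ha|hd].
    apply: (line_crossing_inner_d hF hlmax hl0 cgf hC).
    exact: line_crossing_a_inner.
  exact: line_crossing_d_a.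
have [|ab ac ad] := equiv (sub_psi_class k P F lmax psi l0).
  by move=> SV [].
by split=> //; split; [apply/ab|apply/ac|apply/ad].
Qed.
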